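(* Let a Boolean control network $x(t+1)=Lu(t)x(t)$, $y(t)=Hx(t)$ be given, with weighted pair graph $\mathcal{G}=(\mathcal{V},\mathcal{E},\mathcal{W})$. The network is not Type-1 observable if and only if there is a state $\delta_N^i$ occurring in some non-diagonal vertex of $\mathcal{G}$ such that the deterministic finite automaton $A_{\delta_N^i}$ is complete.
   Context: Fix positive integers $n,m,q$ and put $N=2^n$, $M=2^m$, $Q=2^q$. For a positive integer $k$, $\delta_k^i$ is the $i$-th column of the identity matrix $I_k$ and $\Delta_k=\{\delta_k^1,\dots,\delta_k^k\}$. A logical matrix of size $k\times s$ is one all of whose columns lie in $\Delta_k$. A Boolean control network (BCN, in algebraic form) is a system $x(t+1)=Lu(t)x(t)$, $y(t)=Hx(t)$, $t=0,1,2,\dots$, with states $x(t)\in\Delta_N$, inputs $u(t)\in\Delta_M$, outputs $y(t)\in\Delta_Q$, where $L$ is an $N\times NM$ logical matrix and $H$ is a $Q\times N$ logical matrix. Products are semi-tensor products; concretely $Lux=L(u\otimes x)$ for $u\in\Delta_M$, $x\in\Delta_N$, with $\otimes$ the Kronecker product. For $x_0\in\Delta_N$, $p\ge 1$ and $U=u_0\cdots u_{p-1}\in(\Delta_M)^p$, put $x_{t+1}=Lu_tx_t$ for $0\le t<p$ and $(HL)_{x_0}^p(U)=(Hx_1)\cdots(Hx_p)\in(\Delta_Q)^p$. Type-1 observability: for every $x_0\in\Delta_N$ there exist $p\ge1$ and $U\in(\Delta_M)^p$ such that for all $\bar x_0\in\Delta_N$ with $\bar x_0\ne x_0$, $Hx_0=H\bar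 x_0$ implies $(HL)_{x_0}^p(U)\neq(HL)_{\bar x_0}^p(U)$. Weighted pair graph $\mathcal{G}=(\mathcal{V},\mathcal{E},\mathcal{W})$: $\mathcal{V}$ is the set of unordered pairs $(x,x')$ (so $(x,x')=(x',x)$, and $x=x'$ is allowed) of elements of $\Delta_N$ with $Hx=Hx'$. For vertices $v=(x_1,x_1')$, $w=(x_2,x_2')$, let $\mathcal{W}((v,w))$ be the set of $u\in\Delta_M$ such that ($Lux_1=x_2$ and $Lux_1'=x_2'$) or ($Lux_1=x_2'$ and $Lux_1'=x_2$). The directed edge $(v,w)$ belongs to $\mathcal{E}$ iff this set is nonempty, and then it is the weight of the edge. A vertex $(x,x)$ is called diagonal; the other vertices are non-diagonal. A deterministic finite automaton (DFA) is $A=(S,\Sigma,\sigma,s_0,F)$ with finite state set $S$, finite nonempty alphabet $\Sigma$, initial state $s_0\in S$, final states $F\subset S$, and a partial transition function $\sigma:S\times\Sigma\to S$. It is complete if $\sigma$ is a total function (defined at every pair $(s,a)\in S\times\Sigma$, equivalently its natural extension to $S\times\Sigma^*$ is total). The DFA $A_{\delta_N^i}$: its alphabet is $\Delta_M$; its states are subsets of $\mathcal{V}$; its initial state $s_0$ is the set of all non-diagonal vertices of $\mathcal{V}$ containing $\delta_N^i$. For a state $s$ and a letter $\delta_M^j$, let $s'=\{v\in\mathcal{V}\mid \text{there is } v'\in s\text{ with }(v',v)\in\mathcal{E}\text{ and }\delta_M^j\in\mathcal{W}((v',v))\}$; if $s'\neq\emptyset$ then the transition function at $(s,\delta_M^j)$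 takes the value $s'$, and otherwise it is undefined there. The state set consists of $s_0$ and all sets obtained from $s_0$ by repeatedly applying these transitions. All states are final. *)

(* Defs.v *)
From HB Require Import structures.
From mathcomp Require Import all_boot all_order all_algebra.
From mathcomp Require Import mxtens.

Set Implicit Arguments.
Unset Strict Implicit.
Unset Printing Implicit Defensive.
Import GRing.Theory.
Local Open Scope ring_scope.

(* The coefficient ring R is arbitrary: only the scalars 0 and 1 occur, so R   *)
(* can be the reals or any other nontrivial ring.                              *)

Definition delta_col (R : nzRingType) (k : nat) (i : 'I_k) : 'cV[R]_k :=
  col i 1%:M.

Record Delta (R : nzRingType) (k : nat) := MkDelta {
  Delta_col :> 'cV[R]_k;
  Delta_colP : Delta_col \in codom (@delta_col R k)
}.

Section DeltaFinType.

Variables (R : nzRingType) (k : nat).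

HB.instance Definition _ := [isSub for @Delta_col R k].
HB.instance Definition _ := [Choice of Delta R k by <:].

Let to_seq_sub (x : Delta R k) : seq_sub (codom (@delta_col R k)) :=
  SeqSub (Delta_colP x).
Let of_seq_sub (y : seq_sub (codom (@delta_col R k))) : Delta R k :=
  MkDelta (ssvalP y).

Lemma to_seq_subK : cancel to_seq_sub of_seq_sub.
Proof. by case. Qed.

HB.instance Definition _ := CanIsCountable to_seq_subK.
HB.instance Definition _ : isFinite (Delta R k) := CanIsFinite to_seq_subK.

End DeltaFinType.

(* Indices start at 0: [delta R i] is $\delta_k^{i+1}$. *)
Definition delta (R : nzRingType) (k : nat) (i : 'I_k) : Delta R k :=
  MkDelta (codom_f (@delta_col R k) i).

Definition logical_mx (R : nzRingType) (k s : nat) (A : 'M[R]_(k, s)) : bool :=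
  [forall j, col j A \in codom (@delta_col R k)].

Section BCN.

Variables (R : nzRingType) (N M Q : nat).
Variables (L : 'M[R]_(N, M * N)) (H : 'M[R]_(Q, N)).

(* $Lux = L(u \otimes x)$; the column index type of u *t x is 'I_(1 * 1),      *)
(* which is convertible to 'I_1.                                               *)
Definition bcn_next (x : 'cV[R]_N) (u : 'cV[R]_M) : 'cV[R]_N :=
  L *m (u *t x : 'cV[R]_(M * N)).

(* [scanl] yields x_1, ..., x_p, without the initial state x_0. *)
Definition bcn_outputs (x0 : Delta R N) (U : seq (Delta R M)) : seq 'cV[R]_Q :=
  [seq H *m x | x <- scanl (fun x (u : Delta R M) => bcn_next x u)
                           (x0 : 'cV[R]_N) U].

Definition type1_observable : Prop :=
  forall x0 : Delta R N,
  exists p : nat, (1 <= p)%N /\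
  exists U : p.-tuple (Delta R M),
  forall x0' : Delta R N, x0' <> x0 ->
    H *m x0 = H *m x0' -> bcn_outputs x0 U <> bcn_outputs x0' U.

(* The unordered pair (x, x') is encoded as the set {x, x'}, which is a        *)
(* singleton when x = x'.                                                      *)
Definition pg_vertices : {set {set Delta R N}} :=
  [set v : {set Delta R N} | [exists x : Delta R N, exists x' : Delta R N,
    (v == [set x; x']) && (H *m x == H *m x')]].

Definition pg_weight (v w : {set Delta R N}) : {set Delta R M} :=
  [set u : Delta R M |
    [exists x1 : Delta R N, exists x1' : Delta R N,
     exists x2 : Delta R N, exists x2' : Delta R N,
      [&& v == [set x1; x1'], w == [set x2; x2']
        & (bcn_next x1 u == x2) && (bcn_next x1' u == x2')
          || (bcn_next x1 u == x2') && (bcn_next x1' u == x2)]]].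

Definition pg_edge : rel {set Delta R N} := fun v w =>
  [&& v \in pg_vertices, w \in pg_vertices & pg_weight v w != set0].

Definition pg_diagonal (v : {set Delta R N}) : bool :=
  [exists x : Delta R N, v == [set x; x]].

Definition pg_nondiagonal_at (x : Delta R N) : {set {set Delta R N}} :=
  [set v in pg_vertices | ~~ pg_diagonal v & x \in v].

End BCN.

Record dfa := DFA {
  dfa_state : finType;
  dfa_letter : finType;
  dfa_trans : dfa_state -> dfa_letter -> option dfa_state;
  dfa_init : dfa_state;
  dfa_final : {set dfa_state};
  dfa_letter_neq0 : (0 < #|{: dfa_letter}|)%N
}.

Definition dfa_complete (A : dfa) : Prop :=
  forall (s : dfa_state A) (a : dfa_letter A), dfa_trans s a <> None.

Lemma card_Delta (R : nzRingType) k : (0 < k)%N -> (0 < #|{: Delta R k}|)%N.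
Proof. by move=> k_gt0; apply/card_gt0P; exists (delta R (Ordinal k_gt0)). Qed.

Section ObservabilityDFA.

Variables (R : nzRingType) (N M Q : nat) (M_gt0 : (0 < M)%N).
Variables (L : 'M[R]_(N, M * N)) (H : 'M[R]_(Q, N)) (x : Delta R N).

Definition obs_succ (s : {set {set Delta R N}}) (u : Delta R M) :
    {set {set Delta R N}} :=
  [set v in pg_vertices H |
    [exists v' in s, pg_edge L H v' v && (u \in pg_weight L v' v)]].

Definition obs_step : rel {set {set Delta R N}} := fun s t =>
  [exists u : Delta R M, (obs_succ s u != set0) && (t == obs_succ s u)].

Definition obs_state : Type :=
  {s : {set {set Delta R N}} | connect obs_step (pg_nondiagonal_at H x) s}.
HB.instance Definition _ := SubType.on obs_state.
HB.instance Definition _ := Finite.on obs_state.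

Definition obs_init : obs_state :=
  exist _ (pg_nondiagonal_at H x) (connect0 obs_step _).

(* A nonempty successor is reachable, so [insub] never fails on it: see        *)
(* [obs_transE].                                                               *)
Definition obs_trans (s : obs_state) (u : Delta R M) : option obs_state :=
  if obs_succ (val s) u != set0 then insub (obs_succ (val s) u) else None.

Lemma obs_transE (s : obs_state) (u : Delta R M) :
  omap val (obs_trans s u) =
  if obs_succ (val s) u != set0 then Some (obs_succ (val s) u) else None.
Proof.
rewrite /obs_trans; case: ifP => // nz; rewrite insubT //=.
apply: connect_trans (valP s) (connect1 _).
by apply/existsP; exists u; rewrite nz eqxx.
Qed.

Definition obs_dfa : dfa :=
  DFA obs_trans obs_init [set: obs_state] (card_Delta R M_gt0).

End ObservabilityDFA.

Lemma expn2_gt0 (k : nat) : (0 < 2 ^ k)%N.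
Proof. by rewrite expn_gt0. Qed.

(* Main.v *)
Require Import Defs.
From mathcomp Require Import all_boot all_order all_algebra.
From mathcomp Require Import mxtens.

Set Implicit Arguments.
Unset Strict Implicit.
Unset Printing Implicit Defensive.
Import GRing.Theory.
Local Open Scope ring_scope.

(** A word U drives the automaton of x0 from its initial state to the set of
    those pairs {x_p, x_p'} that are reached, under U, by a pair of initial
    states {x0, x0'} with x0' distinct from x0 which produces equal outputs at
    times 0, ..., p ([foldl_obs_succ_neq0]). The reached set is thus empty
    exactly when U determines x0 from the outputs: the nonempty words that the
    automaton does not accept are those that type-1 observability asks for. Completeness says that, from every reachable state, each letter has a
    nonempty successor, so, once the initial state is nonempty, it says that no
    word determines x0 ([distinguishing_wordP]).

    Pairs are unordered, and may merge into a diagonal vertex {x, x}; both are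
    harmless, since the successor of a pair under a letter is just its image
    under the next-state map ([pg_weight_set2]), and a diagonal vertex always
    has a successor. That map does send [Delta] to [Delta], because u (x) x is
    again a canonical basis vector and L is logical ([bcn_next_in_Delta]).

    Completeness of a finite automaton is decidable, so the negation of
    observability yields an undetermined initial state without any appeal to
    classical logic. *)

Lemma eq_set2 (T : finType) (a b c d : T) :
  [set a; b] = [set c; d] -> (a = c /\ b = d) \/ (a = d /\ b = c).
Proof.
move=> e; have ha := set21 a b; have hb := set22 a b.
have hc := set21 c d; have hd := set22 c d.
rewrite e in ha hb; rewrite -e in hc hd.
case/set2P: ha => ?; case/set2P: hb => ?; subst; auto.
  by move: hd; rewrite setUid => /set1P->; left.
by move: hc; rewrite setUid => /set1P->; left.
Qed.

Lemma delta_colE (R : nzRingType) k (i : 'I_k) :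
  delta_col R i = delta_mx i 0.
Proof. by rewrite /delta_col colE mul1mx. Qed.

Lemma Delta_deltaP (R : nzRingType) k (x : Delta R k) :
  exists i, x = delta R i.
Proof. by have /codomP[i e] := Delta_colP x; exists i; apply: val_inj. Qed.

Lemma tens_delta_col (R : nzRingType) M N (i : 'I_M) (j : 'I_N) :
  (delta_col R i *t delta_col R j : 'cV[R]_(M * N)) =
  delta_col R (mxtens_index (i, j)).
Proof.
apply/matrixP=> k l; case: (mxtens_indexP k) => k1 k2.
rewrite !delta_colE !mxE mxtens_indexK /= !ord1 !eqxx !andbT -natrM mulnb.
by rewrite (can_eq (@mxtens_indexK _ _)) xpair_eqE.
Qed.

Section PairGraph.

Variables (R : nzRingType) (N M Q : nat).
Variables (L : 'M[R]_(N, M * N)) (H : 'M[R]_(Q, N)).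
Hypothesis L_logical : logical_mx L.

Lemma bcn_next_in_Delta (x : Delta R N) (u : Delta R M) :
  bcn_next L x u \in codom (@delta_col R N).
Proof.
have [i ->] := Delta_deltaP x; have [j ->] := Delta_deltaP u.
rewrite /bcn_next tens_delta_col delta_colE -colE.
exact: (forallP L_logical).
Qed.

Definition next_state (x : Delta R N) (u : Delta R M) : Delta R N :=
  MkDelta (bcn_next_in_Delta x u).

Lemma pg_vertices_set2 (a b : Delta R N) :
  ([set a; b] \in pg_vertices H) = (H *m a == H *m b).
Proof.
rewrite inE; apply/existsP/idP => [[c /existsP[d /andP[/eqP e /eqP h]]]|h].
  by case: (eq_set2 e) => -[-> ->]; apply/eqP.
by exists a; apply/existsP; exists b; rewrite eqxx.
Qed.

Lemma pg_diagonal_set2 (a b : Delta R N) : pg_diagonal [set a; b] = (a == b).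
Proof.
apply/existsP/eqP => [[c /eqP e]|->]; last by exists b.
by case: (eq_set2 e) => -[-> ->].
Qed.

(** The two alternatives in the definition of a weight, and the choice of an
    order on either pair, all collapse to taking the image of the pair. *)
Lemma pg_weight_set2 (a b : Delta R N) w (u : Delta R M) :
  (u \in pg_weight L [set a; b] w) =
  (w == [set next_state a u; next_state b u]).
Proof.
rewrite inE; apply/idP/eqP => [|->].
  case/existsP=> x1 /existsP[x1' /existsP[x2 /existsP[x2']]].
  case/and3P=> /eqP/eq_set2 e1 /eqP-> e2.
  have {e2} e2 : [set x2; x2'] = [set next_state x1 u; next_state x1' u].
    case/orP: e2 => /andP[/eqP h /eqP h'].
      by congr [set _; _]; apply: val_inj.
    by rewrite setUC; congr [set _; _]; apply: val_inj.
  by rewrite e2; case: e1 => -[-> ->]; rewrite // setUC.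
apply/existsP; exists a; apply/existsP; exists b; apply/existsP.
exists (next_state a u); apply/existsP; exists (next_state b u).
by rewrite !eqxx.
Qed.

Lemma obs_succP (s : {set {set Delta R N}}) (u : Delta R M) v :
    s \subset pg_vertices H ->
  reflect (exists a b, [/\ [set a; b] \in s,
             H *m next_state a u = H *m next_state b u
           & v = [set next_state a u; next_state b u]])
          (v \in obs_succ L H s u).
Proof.
move=> sV; rewrite inE; apply: (iffP andP) => [[vV /existsP[v' h]]|].
  case/and3P: h => v's _; have := subsetP sV _ v's.
  rewrite inE => /existsP[a /existsP[b /andP[/eqP ev' _]]].
  rewrite ev' pg_weight_set2 => /eqP ev; exists a, b.
  by split; rewrite -?ev' //; apply/eqP; rewrite -pg_vertices_set2 -ev.
case=> a [b [abs /eqP eH ->]]; rewrite pg_vertices_set2 eH; split=> //.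
have uw : u \in pg_weight L [set a; b] [set next_state a u; next_state b u].
  by rewrite pg_weight_set2.
apply/existsP; exists [set a; b]; rewrite abs uw andbT /=.
apply/and3P; split; first exact: (subsetP sV).
  by rewrite pg_vertices_set2.
by apply/set0Pn; exists u.
Qed.

Lemma obs_succ_sub s u : obs_succ L H s u \subset pg_vertices H.
Proof. by apply/subsetP=> v; rewrite inE => /andP[]. Qed.

Lemma pg_nondiagonal_at_sub (x : Delta R N) :
  pg_nondiagonal_at H x \subset pg_vertices H.
Proof. by apply/subsetP=> v; rewrite inE => /andP[]. Qed.

(** Reading U from s keeps exactly the pairs of s that U fails to separate. *)
Lemma foldl_obs_succ_neq0 (U : seq (Delta R M)) (s : {set {set Delta R N}}) :
    s \subset pg_vertices H ->
  (foldl (obs_succ L H) s U != set0) <->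
  (exists a b : Delta R N, [set a; b] \in s /\
     bcn_outputs L H a U = bcn_outputs L H b U).
Proof.
elim: U s => [|u U IHU] s sV /=.
  split=> [/set0Pn[v vs]|[a [b [abs _]]]]; last first.
    by apply/set0Pn; exists [set a; b].
  have := subsetP sV _ vs; rewrite inE => /existsP[a /existsP[b]].
  by case/andP=> /eqP ev _; exists a, b; rewrite -ev.
have outputsS x : bcn_outputs L H x (u :: U) =
    H *m next_state x u :: bcn_outputs L H (next_state x u) U by [].
apply: iff_trans (IHU _ (obs_succ_sub s u)) _; split.
  case=> c [d [/(obs_succP _ _ sV)[a [b [abs eH /eq_set2 e]]] eo]].
  exists a, b; split=> //; rewrite !outputsS eH; congr (_ :: _).
  by case: e eo => -[-> ->].
case=> a [b [abs]]; rewrite !outputsS => -[eH eo].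
exists (next_state a u), (next_state b u); split=> //.
by apply/(obs_succP _ _ sV); exists a, b.
Qed.

Lemma pg_nondiagonal_atP (x : Delta R N) v :
  reflect (exists y : Delta R N,
             [/\ y <> x, H *m x = H *m y & v = [set x; y]])
          (v \in pg_nondiagonal_at H x).
Proof.
rewrite inE; apply: (iffP and3P) => [[]|[y [/eqP yx eH ->]]]; last first.
  by rewrite pg_vertices_set2 eH pg_diagonal_set2 eq_sym yx set21.
rewrite inE => /existsP[a /existsP[b /andP[/eqP-> /eqP eH]]].
rewrite pg_diagonal_set2 => /eqP ab /set2P[-> | ->].
  by exists b; split=> // /esym.
by exists a; rewrite setUC.
Qed.

(** The words that are read into the empty set of pairs are the ones that
    type-1 observability requires. *)
Lemma foldl_obs_succ_eq0 (x : Delta R N) (U : seq (Delta R M)) :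
  foldl (obs_succ L H) (pg_nondiagonal_at H x) U = set0 <->
  forall y : Delta R N, y <> x -> H *m x = H *m y ->
    bcn_outputs L H x U <> bcn_outputs L H y U.
Proof.
have [_ sep] := foldl_obs_succ_neq0 U (pg_nondiagonal_at_sub x).
split=> [e0 y yx eH eo | noty].
  suff /eqP[] : foldl (obs_succ L H) (pg_nondiagonal_at H x) U != set0 by [].
  by apply: sep; exists x, y; split=> //; apply/pg_nondiagonal_atP; exists y.
apply/eqP/negPn/negP=> /(foldl_obs_succ_neq0 U (pg_nondiagonal_at_sub x)).
case=> a [b [/pg_nondiagonal_atP[y [yx eH /eq_set2 e]] eo]].
by apply: (noty y yx eH); case: e eo => -[-> ->].
Qed.

Lemma foldl_obs_succ_reachable (x : Delta R N) (s : obs_state L H x) :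
  exists U, val s = foldl (obs_succ L H) (pg_nondiagonal_at H x) U.
Proof.
case: s => s /= /connectP[p pp ->] {s}.
elim: p (pg_nondiagonal_at H x) pp => [|t p IHp] s /=; first by exists [::].
case/andP=> /existsP[u /andP[_ /eqP->]] /IHp[U ->].
by exists (u :: U).
Qed.

Definition obs_completeb (x : Delta R N) : bool :=
  [forall s : obs_state L H x, forall u, obs_succ L H (val s) u != set0].

Lemma obs_completeP (M_gt0 : (0 < M)%N) (x : Delta R N) :
  reflect (dfa_complete (obs_dfa M_gt0 L H x)) (obs_completeb x).
Proof.
apply: (iffP 'forall_forallP) => cpl s u; have := obs_transE s u.
  by rewrite (cpl s u) /=; case: (obs_trans s u).
by case: ifP => // _; have := cpl s u; rewrite /=; case: (obs_trans s u).
Qed.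

Lemma obs_complete_foldl (x : Delta R N) (U : seq (Delta R M)) :
    pg_nondiagonal_at H x != set0 -> obs_completeb x ->
  foldl (obs_succ L H) (pg_nondiagonal_at H x) U != set0.
Proof.
move=> ne /'forall_forallP cpl.
(* Nonemptiness propagates because the reached set is again a state. *)
suff [s [<- //]] : exists s : obs_state L H x,
    val s = foldl (obs_succ L H) (pg_nondiagonal_at H x) U /\ val s != set0.
elim/last_ind: U => [|U u [s [es _]]]; first by exists (obs_init L H x).
rewrite foldl_rcons -es; have nz := cpl s u; have := obs_transE s u.
by rewrite nz; case: (obs_trans s u) => [t|] //= [et]; exists t; rewrite et.
Qed.

(** If completeness fails, a word leading to a defective state, followed by a
    letter without successor, determines x; it is nonempty because of that
    letter. If the initial state is empty, any letter will do, whence the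
    positivity of M. *)
Lemma distinguishing_wordP (M_gt0 : (0 < M)%N) (x : Delta R N) :
  (exists p, (1 <= p)%N /\ exists U : p.-tuple (Delta R M),
    forall y : Delta R N, y <> x -> H *m x = H *m y ->
      bcn_outputs L H x U <> bcn_outputs L H y U) <->
  ~~ ((pg_nondiagonal_at H x != set0) && obs_completeb x).
Proof.
split=> [[p [_ [U /foldl_obs_succ_eq0/eqP eU]]]|].
  by apply: contraL eU => /andP[ne cpl]; apply: obs_complete_foldl.
have word (U : seq (Delta R M)) : (0 < size U)%N ->
    foldl (obs_succ L H) (pg_nondiagonal_at H x) U = set0 ->
    exists p, (1 <= p)%N /\ exists U : p.-tuple (Delta R M),
      forall y : Delta R N, y <> x -> H *m x = H *m y ->
      bcn_outputs L H x U <> bcn_outputs L H y U.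
  move=> U_gt0 /foldl_obs_succ_eq0 eU.
  by exists (size U); split=> //; exists (in_tuple U).
rewrite negb_and negbK => /orP[/eqP e0|].
  apply: (word [:: delta R (Ordinal M_gt0)]) => //=; rewrite e0.
  apply/setP=> v; rewrite !inE; apply/negP=> /andP[_ /existsP[w]].
  by rewrite inE.
rewrite negb_forall => /existsP[s]; rewrite negb_forall => /existsP[u].
have [U es] := foldl_obs_succ_reachable s.
rewrite negbK es -foldl_rcons => /eqP; apply: word.
by rewrite size_rcons.
Qed.

End PairGraph.

Theorem mainTheorem2 (R : nzRingType) (n m q : nat)
    (n_gt0 : (0 < n)%N) (m_gt0 : (0 < m)%N) (q_gt0 : (0 < q)%N)
    (L : 'M[R]_(2 ^ n, 2 ^ m * 2 ^ n)) (H : 'M[R]_(2 ^ q, 2 ^ n))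
    (L_logical : logical_mx L) (H_logical : logical_mx H) :
  ~ type1_observable L H <->
  exists i : 'I_(2 ^ n),
    (exists v : {set Delta R (2 ^ n)},
       [/\ v \in pg_vertices H, ~~ pg_diagonal v & delta R i \in v]) /\
    dfa_complete (obs_dfa (expn2_gt0 m) L H (delta R i)).
Proof.
pose M_gt0 := expn2_gt0 m.
split=> [nobs|[i [[v [vV vnd iv]] /(obs_completeP L H M_gt0) cpl]] obs].
  have [/existsP[x /andP[/set0Pn[v]]]|none] := boolP
      [exists x, (pg_nondiagonal_at H x != set0) && obs_completeb L H x].
    have [i ->] := Delta_deltaP x; rewrite inE => /and3P[vV vnd iv] cpl.
    exists i; split; first by exists v.
    exact/obs_completeP.
  case: nobs => x; apply/(distinguishing_wordP H L_logical M_gt0).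
  by move: none; rewrite negb_exists => /forallP.
have /(distinguishing_wordP H L_logical M_gt0)/negP[] := obs (delta R i).
by rewrite cpl andbT; apply/set0Pn; exists v; rewrite inE vV vnd.
Qed.
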